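(* Let $\mathbf{k}$ be a commutative ring with unit, $\lambda\in\mathbf{k}$, and $\Omega$ a semigroup. Let $(R,\{P_\omega\mid\omega\in\Omega\})$ be a Rota-Baxter family algebra of weight $\lambda$. Then $(R\otimes\mathbf{k}\Omega,P)$ is a Rota-Baxter algebra of weight $\lambda$, where $P:R\otimes\mathbf{k}\Omega\to R\otimes\mathbf{k}\Omega$ is the $\mathbf{k}$-linear map given by $P(x\otimes\omega)=P_\omega(x)\otimes\omega$ for $x\in R$, $\omega\in\Omega$.
   Context: Algebras are associative $\mathbf{k}$-algebras (not necessarily unital or commutative), and $\Omega$ is a semigroup, not necessarily commutative. Tensor products are over $\mathbf{k}$. $\mathbf{k}\Omega$ is the semigroup algebra of $\Omega$ (free $\mathbf{k}$-module on $\Omega$ with product extending that of $\Omega$), and $R\otimes\mathbf{k}\Omega$ carries the tensor product algebra structure $(x\otimes\alpha)(y\otimes\beta)=xy\otimes\alpha\beta$. A Rota-Baxter algebra of weight $\lambda$ is a pair $(R,P)$ with $R$ an algebra and $P:R\to R$ a $\mathbf{k}$-linear operator such that $P(a)P(b)=P\bigl(P(a)b+aP(b)+\lambda ab\bigr)$ for all $a,b\in R$. A Rota-Baxter family algebra of weight $\lambda$ (indexed by $\Omega$) is a pair $(R,\{P_\omega\mid\omega\in\Omega\})$ with $R$ an algebra and $P_\omega:R\to R$ $\mathbf{k}$-linear operators such that $P_\alpha(a)P_\beta(b)=P_{\alpha\beta}\bigl(P_\alpha(a)b+aP_\beta(b)+\lambda ab\bigr)$ for all $a,b\in R$ and $\alpha,\beta\in\Omega$.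 *)

(* Defs.v *)
From HB Require Import structures.
From mathcomp Require Import all_boot all_algebra.
From mathcomp Require Import finmap boolp monalg.

Set Implicit Arguments.
Unset Strict Implicit.
Unset Printing Implicit Defensive.

Import GRing.Theory.

Local Open Scope ring_scope.
Local Open Scope quotient_scope.

Reserved Notation "x ** y" (at level 40, left associativity).
Reserved Notation "x ⊗ y" (at level 40, left associativity).

(* Associative algebras over a commutative ring, with no unit and no          *)
(* commutativity assumed.                                                     *)

HB.mixin Record isNonUnitalAlgebra (k : comPzRingType) A of GRing.Lmodule k A := {
  amul : A -> A -> A;
  amulA : associative amul;
  amulDl : forall a b c, amul (a + b) c = amul a c + amul b c;
  amulDr : forall a b c, amul a (b + c) = amul a b + amul a c;
  amulZl : forall (l : k) a b, amul (l *: a) b = l *: amul a b;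
  amulZr : forall (l : k) a b, amul a (l *: b) = l *: amul a b
}.

#[short(type="nonUnitalAlgType")]
HB.structure Definition NonUnitalAlgebra (k : comPzRingType) :=
  {A of isNonUnitalAlgebra k A & GRing.Lmodule k A}.

Notation "x ** y" := (amul x y) : ring_scope.

(* The free k-module on X. The carrier is that of {malg k[X]}, whose library  *)
(* scaling requires 1 != 0 in k; the alias carries a scaling for any ring k.  *)

Definition freemod (k : pzRingType) (X : choiceType) : Type := {malg k[X]}.

HB.instance Definition _ (k : pzRingType) (X : choiceType) :=
  GRing.Zmodule.copy (freemod k X) {malg k[X]}.

(* Locked definitions keep failing unifications from evaluating finite        *)
(* supports and quotient representatives.                                     *)
Fact tens_key : unit. Proof. exact: tt. Qed.

Section FreeModule.
Context (k : pzRingType) (X : choiceType).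
Implicit Types (g h : freemod k X) (x : X).

Definition freemod_scale (c : k) g : freemod k X :=
  [malg x in msupp g => c * g@_x].

Lemma freemod_scaleE c g x : (freemod_scale c g)@_x = c * g@_x.
Proof. by rewrite mcoeffE; case: msuppP; rewrite ?mulr0. Qed.

Lemma freemodD g h x : (g + h)@_x = g@_x + h@_x.
Proof. exact: mcoeffD. Qed.

Lemma freemod_scaleA c d g :
  freemod_scale c (freemod_scale d g) = freemod_scale (c * d) g.
Proof. by apply/malgP => x; rewrite !freemod_scaleE mulrA. Qed.

Lemma freemod_scale1 : left_id 1 freemod_scale.
Proof. by move=> g; apply/malgP => x; rewrite freemod_scaleE mul1r. Qed.

Lemma freemod_scaleDr : right_distributive freemod_scale +%R.
Proof.
move=> c g h; apply/malgP => x.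
by rewrite freemodD !freemod_scaleE freemodD mulrDr.
Qed.

Lemma freemod_scaleDl g : {morph freemod_scale^~ g : c d / c + d}.
Proof.
by move=> c d; apply/malgP => x; rewrite freemodD !freemod_scaleE mulrDl.
Qed.

HB.instance Definition _ := GRing.Zmodule_isLmodule.Build k (freemod k X)
  freemod_scaleA freemod_scale1 freemod_scaleDr freemod_scaleDl.

Definition freeU : X -> freemod k X :=
  locked_with tens_key (fun x => << 1 *g x >>).

Lemma freeUE x : freeU x = << 1 *g x >>.
Proof. by rewrite /freeU locked_withE. Qed.

Lemma freemodE g : g = \sum_(x <- msupp g) g@_x *: freeU x.
Proof.
rewrite {1}[g]monalgE; apply: eq_bigr => x _; apply/malgP => y.
by rewrite freeUE freemod_scaleE !mcoeffU mulrnAr mulr1.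
Qed.

Lemma freemodW (Q : freemod k X -> Prop) :
    Q 0 -> (forall x, Q (freeU x)) ->
    (forall c g h, Q g -> Q h -> Q (c *: g + h)) ->
  forall g, Q g.
Proof.
move=> Q0 QU QL g; rewrite [g]freemodE.
by elim/big_rec: _ => // x h _; apply/QL/QU.
Qed.

(* The linear extension of f : X -> V.                                        *)
Definition freelift (V : lmodType k) : (X -> V) -> freemod k X -> V :=
  locked_with tens_key (fun f g => \sum_(x <- msupp g) g@_x *: f x).

Lemma freeliftE (V : lmodType k) (f : X -> V) g :
  freelift f g = \sum_(x <- msupp g) g@_x *: f x.
Proof. by rewrite /freelift locked_withE. Qed.

Section Lift.
Context (V : lmodType k).
Implicit Types f : X -> V.

Lemma freelift_dom f g (d : {fset X}) : (msupp g `<=` d)%fset ->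
  freelift f g = \sum_(x <- d) g@_x *: f x.
Proof.
move=> le_gd; rewrite freeliftE; apply: big_fset_incl => // x _ xg.
by rewrite mcoeff_outdom // scale0r.
Qed.

Lemma freelift_is_linear f : linear (freelift f).
Proof.
move=> c g h; pose d := (msupp (c *: g + h)%R `|` (msupp g `|` msupp h))%fset.
rewrite (@freelift_dom f _ d) ?fsubsetUl //.
rewrite (@freelift_dom f g d) ?(@freelift_dom f h d); first last.
- by rewrite /d fsetUCA fsubsetUl.
- by rewrite /d fsetUA fsubsetUr.
rewrite scaler_sumr -big_split; apply: eq_bigr => x _ /=.
by rewrite freemodD freemod_scaleE scalerDl scalerA.
Qed.

HB.instance Definition _ f :=
  GRing.isLinear.Build k (freemod k X) V *:%R (freelift f)
    (freelift_is_linear f).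

Lemma freeliftU f x : freelift f (freeU x) = f x.
Proof.
rewrite freeUE (@freelift_dom f _ [fset x]%fset) ?msuppU_le //.
by rewrite big_seq_fset1 mcoeffUU scale1r.
Qed.

End Lift.
End FreeModule.

Lemma freelift_fun (k : comPzRingType) (X : choiceType) (V : lmodType k)
    (f f1 f2 : X -> V) c (g : freemod k X) :
  (forall x, f x = c *: f1 x + f2 x) ->
  freelift f g = c *: freelift f1 g + freelift f2 g.
Proof.
move=> fE; rewrite !freeliftE scaler_sumr -big_split.
by apply: eq_bigr => x _ /=; rewrite fE scalerDr !scalerA [c * _]mulrC.
Qed.

Definition bilinear_map (k : pzRingType) (M N V : lmodType k)
    (f : M -> N -> V) : Prop :=
  (forall y, linear (f^~ y)) /\ (forall x, linear (f x)).

(* The tensor product over k: the free module on M * N modulo the submodule   *)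
(* generated by the bilinearity relations.                                    *)

Section TensorDef.
Context (k : comPzRingType) (M N : lmodType k).

Local Notation F := (freemod k (M * N)%type).
Local Notation "[ x , y ]" := (freeU k (x, y)).

Inductive tens_null : F -> Prop :=
| TensAddl x x' y : tens_null ([x + x', y] - [x, y] - [x', y])
| TensAddr x y y' : tens_null ([x, y + y'] - [x, y] - [x, y'])
| TensScalel c x y : tens_null ([c *: x, y] - c *: [x, y])
| TensScaler c x y : tens_null ([x, c *: y] - c *: [x, y])
| TensZero : tens_null 0
| TensLinear c u v : tens_null u -> tens_null v -> tens_null (c *: u + v).

Definition tens_submod : {pred F} := fun u => `[< tens_null u >].

Lemma tens_submodP u : reflect (tens_null u) (u \in tens_submod).
Proof. exact: asboolP. Qed.

Lemma tens_submod_zmod_closed : zmod_closed tens_submod.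
Proof.
split=> [|u v /tens_submodP u0 /tens_submodP v0]; apply/tens_submodP.
  exact: TensZero.
by rewrite addrC -scaleN1r; apply: TensLinear.
Qed.

HB.instance Definition _ :=
  GRing.isZmodClosed.Build F tens_submod tens_submod_zmod_closed.

Definition tens : Type := Quotient.quot tens_submod.

HB.instance Definition _ := GRing.Zmodule.copy tens (Quotient.quot tens_submod).

Definition tens_pi : F -> tens :=
  locked_with tens_key (fun u => \pi_(Quotient.quot tens_submod) u).
Definition tens_repr : tens -> F :=
  locked_with tens_key (fun t => repr (t : Quotient.quot tens_submod)).

Lemma tens_reprK : cancel tens_repr tens_pi.
Proof.
move=> t; rewrite /tens_pi /tens_repr !locked_withE.
exact: (@reprK _ (Quotient.quot tens_submod)).
Qed.

Lemma tens_piP u v : tens_pi u = tens_pi v <-> tens_null (u - v).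
Proof.
rewrite /tens_pi locked_withE; split=> [/eqP|uv].
  by rewrite -Quotient.idealrBE => /tens_submodP.
by apply/eqP; rewrite -Quotient.idealrBE; apply/tens_submodP.
Qed.

Lemma tens_piD u v : tens_pi (u + v) = tens_pi u + tens_pi v.
Proof. by rewrite /tens_pi locked_withE; apply: Quotient.pi_add. Qed.

Definition tens_scale (c : k) (t : tens) : tens := tens_pi (c *: tens_repr t).

Lemma tens_scale_pi c u : tens_scale c (tens_pi u) = tens_pi (c *: u).
Proof.
apply/tens_piP; rewrite -scalerBr -[_ *: _]addr0.
by apply: TensLinear; [apply/tens_piP; rewrite tens_reprK | apply: TensZero].
Qed.

Lemma tens_scaleA c d t : tens_scale c (tens_scale d t) = tens_scale (c * d) t.
Proof. by rewrite -[t]tens_reprK !tens_scale_pi scalerA. Qed.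

Lemma tens_scale1 : left_id 1 tens_scale.
Proof. by move=> t; rewrite -[t]tens_reprK tens_scale_pi scale1r. Qed.

Lemma tens_scaleDr : right_distributive tens_scale +%R.
Proof.
move=> c t u; rewrite -[t]tens_reprK -[u]tens_reprK.
by rewrite -tens_piD !tens_scale_pi scalerDr tens_piD.
Qed.

Lemma tens_scaleDl t : {morph tens_scale^~ t : c d / c + d}.
Proof.
move=> c d; rewrite -[t]tens_reprK !tens_scale_pi.
by rewrite scalerDl tens_piD.
Qed.

HB.instance Definition _ := GRing.Zmodule_isLmodule.Build k tens
  tens_scaleA tens_scale1 tens_scaleDr tens_scaleDl.

Lemma tens_piZD c u v : tens_pi (c *: u + v) = c *: tens_pi u + tens_pi v.
Proof. by rewrite tens_piD -tens_scale_pi. Qed.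

Definition tpure (x : M) (y : N) : tens := tens_pi [x, y].

Lemma tpureDl x x' y : tpure (x + x') y = tpure x y + tpure x' y.
Proof.
rewrite /tpure -tens_piD; apply/tens_piP.
by rewrite opprD addrA; apply: TensAddl.
Qed.

Lemma tpureDr x y y' : tpure x (y + y') = tpure x y + tpure x y'.
Proof.
rewrite /tpure -tens_piD; apply/tens_piP.
by rewrite opprD addrA; apply: TensAddr.
Qed.

Lemma tpureZl c x y : tpure (c *: x) y = c *: tpure x y.
Proof.
by rewrite /tpure /(_ *: tens_pi _) /= tens_scale_pi; apply/tens_piP/TensScalel.
Qed.

Lemma tpureZr c x y : tpure x (c *: y) = c *: tpure x y.
Proof.
by rewrite /tpure /(_ *: tens_pi _) /= tens_scale_pi; apply/tens_piP/TensScaler.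
Qed.

Lemma tpure_bilinear : bilinear_map tpure.
Proof.
split=> [y c x x'|x c y y']; first by rewrite tpureDl tpureZl.
by rewrite tpureDr tpureZr.
Qed.

Lemma tensW (Q : tens -> Prop) :
    Q 0 -> (forall x y, Q (tpure x y)) ->
    (forall c t u, Q t -> Q u -> Q (c *: t + u)) ->
  forall t, Q t.
Proof.
move=> Q0 QP QL t; rewrite -[t]tens_reprK.
elim/freemodW: (tens_repr t) => [|[x y]|c u v IHu IHv]; last 1 first.
- by rewrite tens_piZD; apply: QL.
- suff -> : tens_pi 0 = 0 by [].
  by apply: (addrI (tens_pi 0)); rewrite -tens_piD !addr0.
- exact: QP.
Qed.

(* The linear map induced by f : M -> N -> V, when f is bilinear.             *)
Definition tlift (V : lmodType k) (f : M -> N -> V) (t : tens) : V :=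
  freelift (fun p => f p.1 p.2) (tens_repr t).

Section Lift.
Context (V : lmodType k).
Implicit Type f : M -> N -> V.

Lemma freelift_tens_null f u : bilinear_map f -> tens_null u ->
  freelift (fun p => f p.1 p.2) u = 0.
Proof.
case=> fl fr.
have fDl x x' y : f (x + x') y = f x y + f x' y.
  by have := fl y 1 x x'; rewrite !scale1r.
have fDr x y y' : f x (y + y') = f x y + f x y'.
  by have := fr x 1 y y'; rewrite !scale1r.
have f0l y : f 0 y = 0 by apply: (addrI (f 0 y)); rewrite -fDl !addr0.
have f0r x : f x 0 = 0 by apply: (addrI (f x 0)); rewrite -fDr !addr0.
elim=> [x x' y|x y y'|c x y|c x y||c v w _ IHv _ IHw].
- by rewrite !linearB /= !freeliftU /= fDl addrAC addrK subrr.
- by rewrite !linearB /= !freeliftU /= fDr addrAC addrK subrr.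
- rewrite linearB linearZ /= !freeliftU /=.
  by have := fl y c x 0; rewrite !addr0 => ->; rewrite f0l addr0 subrr.
- rewrite linearB linearZ /= !freeliftU /=.
  by have := fr x c y 0; rewrite !addr0 => ->; rewrite f0r addr0 subrr.
- exact: linear0.
- by rewrite linearP /= IHv IHw scaler0 addr0.
Qed.

Lemma tlift_pi f u : bilinear_map f ->
  tlift f (tens_pi u) = freelift (fun p => f p.1 p.2) u.
Proof.
move=> fP; apply/eqP; rewrite -subr_eq0 -linearB.
apply/eqP/(freelift_tens_null fP)/tens_piP.
by rewrite tens_reprK.
Qed.

Lemma tlift_pure f x y : bilinear_map f -> tlift f (tpure x y) = f x y.
Proof. by move=> fP; rewrite tlift_pi // freeliftU. Qed.

Lemma tlift_is_linear f : bilinear_map f -> linear (tlift f).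
Proof.
move=> fP c t u; rewrite -[t]tens_reprK -[u]tens_reprK.
by rewrite -tens_piZD !tlift_pi // linearP.
Qed.

Lemma tlift_fun f f1 f2 c t : (forall x y, f x y = c *: f1 x y + f2 x y) ->
  tlift f t = c *: tlift f1 t + tlift f2 t.
Proof. by move=> fE; apply: freelift_fun => p; apply: fE. Qed.

End Lift.
End TensorDef.

Notation "M ⊗ N" := (tens M N) : type_scope.
Notation "x ⊗ y" := (tpure x y) : ring_scope.

Section TensorAlgebra.
Context (k : comPzRingType) (A B : nonUnitalAlgType k).

Definition tens_mul (t u : A ⊗ B) : A ⊗ B :=
  tlift (fun a b => tlift (fun a' b' => (a ** a') ⊗ (b ** b')) u) t.

Lemma tens_mul_inner (a : A) (b : B) :
  bilinear_map (fun (a' : A) (b' : B) => (a ** a') ⊗ (b ** b')).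
Proof.
split=> [b' c x y|a' c x y] /=.
  by rewrite amulDr amulZr tpureDl tpureZl.
by rewrite amulDr amulZr tpureDr tpureZr.
Qed.

Lemma tens_mul_outer (u : A ⊗ B) : bilinear_map (fun (a : A) (b : B) =>
  tlift (fun a' b' => (a ** a') ⊗ (b ** b')) u).
Proof.
split=> [b c x y|a c x y] /=; apply: tlift_fun => a' b'.
  by rewrite amulDl amulZl tpureDl tpureZl.
by rewrite amulDl amulZl tpureDr tpureZr.
Qed.

Lemma tens_mul_pure a b a' b' :
  tens_mul (a ⊗ b) (a' ⊗ b') = (a ** a') ⊗ (b ** b').
Proof.
rewrite /tens_mul tlift_pure; last exact: tens_mul_outer.
by rewrite tlift_pure //; apply: tens_mul_inner.
Qed.

Lemma tens_mul_linearl u : linear (tens_mul^~ u).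
Proof. exact/tlift_is_linear/tens_mul_outer. Qed.

Lemma tens_mul_linearr t : linear (tens_mul t).
Proof.
move=> c u v; apply: tlift_fun => a b.
exact/tlift_is_linear/tens_mul_inner.
Qed.

Lemma tens_mulDl t u v : tens_mul (t + u) v = tens_mul t v + tens_mul u v.
Proof. by have := tens_mul_linearl v 1 t u; rewrite !scale1r. Qed.

Lemma tens_mulDr t u v : tens_mul t (u + v) = tens_mul t u + tens_mul t v.
Proof. by have := tens_mul_linearr t 1 u v; rewrite !scale1r. Qed.

Lemma tens_mul0l t : tens_mul 0 t = 0.
Proof. by apply: (addrI (tens_mul 0 t)); rewrite -tens_mulDl !addr0. Qed.

Lemma tens_mul0r t : tens_mul t 0 = 0.
Proof. by apply: (addrI (tens_mul t 0)); rewrite -tens_mulDr !addr0. Qed.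

Lemma tens_mulZl c t u : tens_mul (c *: t) u = c *: tens_mul t u.
Proof.
by have := tens_mul_linearl u c t 0; rewrite /= addr0 tens_mul0l addr0.
Qed.

Lemma tens_mulZr c t u : tens_mul t (c *: u) = c *: tens_mul t u.
Proof.
by have := tens_mul_linearr t c u 0; rewrite addr0 tens_mul0r addr0.
Qed.

Lemma tens_mulA : associative tens_mul.
Proof.
move=> t u v; elim/tensW: t => [|a b|c t t' IH IH'].
- by rewrite !tens_mul0l.
- elim/tensW: u => [|a' b'|c u u' IH IH'].
  + by rewrite tens_mul0r !tens_mul0l tens_mul0r.
  + elim/tensW: v => [|a2 b2|c v v' IH IH'].
    * by rewrite !tens_mul0r.
    * by rewrite !tens_mul_pure !amulA.
    * by rewrite !(tens_mulDr, tens_mulZr) IH IH'.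
  + by rewrite !(tens_mulDl, tens_mulZl, tens_mulDr, tens_mulZr) IH IH'.
- by rewrite !(tens_mulDl, tens_mulZl) IH IH'.
Qed.

HB.instance Definition _ := isNonUnitalAlgebra.Build k (tens A B)
  tens_mulA tens_mulDl tens_mulDr tens_mulZl tens_mulZr.

Lemma amul_tpure (a a' : A) (b b' : B) :
  (a ⊗ b) ** (a' ⊗ b') = (a ** a') ⊗ (b ** b').
Proof. exact: tens_mul_pure. Qed.

End TensorAlgebra.

Definition semigroup_algebra (k : comPzRingType) (Omega : semigroupType) : Type :=
  freemod k Omega.

HB.instance Definition _ (k : comPzRingType) (Omega : semigroupType) :=
  GRing.Lmodule.copy (semigroup_algebra k Omega) (freemod k Omega).

Section SemigroupAlgebra.
Context (k : comPzRingType) (Omega : semigroupType).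
Local Notation kO := (semigroup_algebra k Omega).
Implicit Types g h : kO.

Definition sgU (w : Omega) : kO := freeU k w.

Definition sg_mul g h : kO :=
  freelift (fun a => freelift (fun b => sgU (a * b)%g) h) g.

Lemma sg_mulU a b : sg_mul (sgU a) (sgU b) = sgU (a * b)%g.
Proof. by rewrite /sg_mul !freeliftU. Qed.

Lemma sg_mul_linearl h : linear (sg_mul^~ h).
Proof. exact: freelift_is_linear. Qed.

Lemma sg_mul_linearr g : linear (sg_mul g).
Proof.
by move=> c u v; apply: freelift_fun => a; apply: freelift_is_linear.
Qed.

Lemma sg_mulDl g h u : sg_mul (g + h) u = sg_mul g u + sg_mul h u.
Proof. by have := sg_mul_linearl u 1 g h; rewrite !scale1r. Qed.

Lemma sg_mulDr g h u : sg_mul g (h + u) = sg_mul g h + sg_mul g u.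
Proof. by have := sg_mul_linearr g 1 h u; rewrite !scale1r. Qed.

Lemma sg_mul0l g : sg_mul 0 g = 0.
Proof. by apply: (addrI (sg_mul 0 g)); rewrite -sg_mulDl !addr0. Qed.

Lemma sg_mul0r g : sg_mul g 0 = 0.
Proof. by apply: (addrI (sg_mul g 0)); rewrite -sg_mulDr !addr0. Qed.

Lemma sg_mulZl c g h : sg_mul (c *: g) h = c *: sg_mul g h.
Proof. by have := sg_mul_linearl h c g 0; rewrite /= addr0 sg_mul0l addr0. Qed.

Lemma sg_mulZr c g h : sg_mul g (c *: h) = c *: sg_mul g h.
Proof. by have := sg_mul_linearr g c h 0; rewrite addr0 sg_mul0r addr0. Qed.

Lemma sg_mulA : associative sg_mul.
Proof.
move=> g h u; elim/freemodW: g => [|x|c g g' IH IH'].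
- by rewrite !sg_mul0l.
- elim/freemodW: h => [|y|c h h' IH IH'].
  + by rewrite sg_mul0r !sg_mul0l sg_mul0r.
  + elim/freemodW: u => [|z|c u u' IH IH'].
    * by rewrite !sg_mul0r.
    * by rewrite !sg_mulU mulgA.
    * by rewrite !(sg_mulDr, sg_mulZr) IH IH'.
  + by rewrite !(sg_mulDl, sg_mulZl, sg_mulDr, sg_mulZr) IH IH'.
- by rewrite !(sg_mulDl, sg_mulZl) IH IH'.
Qed.

HB.instance Definition _ := isNonUnitalAlgebra.Build k kO
  sg_mulA sg_mulDl sg_mulDr sg_mulZl sg_mulZr.

Lemma amul_sgU (a b : Omega) : sgU a ** sgU b = sgU (a * b)%g.
Proof. exact: sg_mulU. Qed.

End SemigroupAlgebra.

Definition rota_baxter (k : comPzRingType) (lambda : k)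
    (R : nonUnitalAlgType k) (P : {linear R -> R}) : Prop :=
  forall a b : R, P a ** P b = P (P a ** b + a ** P b + lambda *: (a ** b)).

Definition rota_baxter_family (k : comPzRingType) (lambda : k)
    (Omega : semigroupType) (R : nonUnitalAlgType k)
    (P : Omega -> {linear R -> R}) : Prop :=
  forall (a b : R) (alpha beta : Omega),
    P alpha a ** P beta b =
      P (alpha * beta)%g
        (P alpha a ** b + a ** P beta b + lambda *: (a ** b)).

(* Main.v *)
(* Both sides of the Rota-Baxter identity are bilinear, so it suffices to     *)
(* check it on the spanning set of tensors x ⊗ w with w in Omega. There,      *)
(* (x ⊗ α)(y ⊗ β) = xy ⊗ αβ turns it into the family identity for x, y, α, β  *)
(* tensored with αβ.                                                          *)

Require Import Defs.
From HB Require Import structures.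
From mathcomp Require Import all_boot all_algebra.

Set Implicit Arguments.
Unset Strict Implicit.
Unset Printing Implicit Defensive.

Import GRing.Theory.
Local Open Scope ring_scope.

(** [family_op] comes from two universal properties: $w \mapsto P_w(x)\otimes w$ extends linearly to
    the free module $\mathbf{k}\Omega$, and the extension is linear in $x$ because each $P_w$ is.
    The tensors $x\otimes w$ span ([tens_sgUW]), which yields uniqueness ([linear_sgU_eq]) and,
    through [rota_baxter_span], reduces the identity to them. *)

Section FamilyOperator.
Context (k : comPzRingType) (Omega : semigroupType) (R : lmodType k).
Local Notation kO := (semigroup_algebra k Omega).

Lemma tens_sgUW (Q : (R ⊗ kO)%type -> Prop) :
    Q 0 -> (forall x w, Q (x ⊗ sgU k w)) ->
    (forall c t u, Q t -> Q u -> Q (c *: t + u)) ->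
  forall t, Q t.
Proof.
move=> Q0 QU QL; apply: tensW => // x; apply: freemodW => [|w|c g h Qg Qh].
- by have := tpureZr 0 x (0 : kO); rewrite !scale0r => ->.
- exact: QU.
- by rewrite (tpureDr x (c *: g : kO) h) (tpureZr c x (g : kO)); apply: QL.
Qed.

Lemma linear_sgU_eq (V : lmodType k) (f g : {linear (R ⊗ kO)%type -> V}) :
  (forall x w, f (x ⊗ sgU k w) = g (x ⊗ sgU k w)) -> f =1 g.
Proof.
move=> fg; elim/tens_sgUW => [|//|c t u IHt IHu]; first by rewrite !linear0.
by rewrite !linearP IHt IHu.
Qed.

Variable P : Omega -> {linear R -> R}.

Definition family_map (x : R) (g : kO) : (R ⊗ kO)%type :=
  freelift (fun w => P w x ⊗ sgU k w) g.

Lemma family_map_bilinear : bilinear_map family_map.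
Proof.
split=> [g c x y|x]; last exact: freelift_is_linear.
by apply: freelift_fun => w; rewrite linearP tpureDl tpureZl.
Qed.

Definition family_op : (R ⊗ kO)%type -> (R ⊗ kO)%type := tlift family_map.

HB.instance Definition _ :=
  GRing.isLinear.Build k (R ⊗ kO)%type (R ⊗ kO)%type *:%R family_op
    (tlift_is_linear family_map_bilinear).

Lemma family_op_sgU x w : family_op (x ⊗ sgU k w) = P w x ⊗ sgU k w.
Proof.
rewrite /family_op tlift_pure ?/family_map ?freeliftU //.
exact: family_map_bilinear.
Qed.

End FamilyOperator.

Section DoubleProduct.
Context (k : comPzRingType) (lambda : k) (A : nonUnitalAlgType k).
Variable P : {linear A -> A}.

(** The double product of Rota-Baxter theory; the Rota-Baxter identity says that [P] is
    multiplicative from it to [**]. *)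
Definition rb_mul (a b : A) : A := P a ** b + a ** P b + lambda *: (a ** b).

Lemma rb_mul_bilinear : bilinear_map rb_mul.
Proof.
split=> [b c x y|a c x y]; rewrite /rb_mul linearP.
- rewrite !(amulDl, amulZl) !scalerDr !scalerA [lambda * c]mulrC.
  by rewrite [X in X + _ = _]addrACA [LHS]addrACA.
- rewrite !(amulDr, amulZr) !scalerDr !scalerA [lambda * c]mulrC.
  by rewrite [X in X + _ = _]addrACA [LHS]addrACA.
Qed.

(** That [S] spans is expressed as an induction principle, applied to each argument in turn. *)
Lemma rota_baxter_span (S : A -> Prop) :
    (forall Q : A -> Prop, Q 0 -> (forall s, S s -> Q s) ->
       (forall c t u, Q t -> Q u -> Q (c *: t + u)) -> forall t, Q t) ->
    (forall a b, S a -> S b -> P a ** P b = P (rb_mul a b)) ->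
  rota_baxter lambda P.
Proof.
move=> span_S PS a b; have [mull mulr] := rb_mul_bilinear.
(* [mull] and [mulr] give linearity as a bare property; $c=-1$ at zero arguments extracts
   $f(0)=0$. *)
have linear_at0 (f : A -> A) : linear f -> f 0 = 0.
  by move=> /(_ (-1) 0 0); rewrite scaler0 addr0 scaleN1r addNr.
have amul0l u : (0 : A) ** u = 0 by rewrite -(scale0r 0) amulZl !scale0r.
have amul0r u : u ** (0 : A) = 0 by rewrite -(scale0r 0) amulZr !scale0r.
rewrite -/(rb_mul a b); move: a b.
apply: (span_S) => [b|a Sa|c a a' IH IH' b].
- by rewrite (linear_at0 _ (mull b)) linear0 amul0l.
- apply: (span_S) => [|b Sb|c b b' IH IH'].
  + by rewrite (linear_at0 _ (mulr a)) linear0 amul0r.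
  + exact: PS.
  + by rewrite mulr !linearP amulDr amulZr IH IH'.
- by rewrite mull !linearP amulDl amulZl IH IH'.
Qed.

End DoubleProduct.

Theorem theorem2p4 (k : comPzRingType) (lambda : k) (Omega : semigroupType)
    (R : nonUnitalAlgType k) (P : Omega -> {linear R -> R})
    (hP : rota_baxter_family lambda P) :
  exists PO : {linear (R ⊗ semigroup_algebra k Omega)%type ->
                      (R ⊗ semigroup_algebra k Omega)%type},
    [/\ forall (x : R) (w : Omega), PO (x ⊗ sgU k w) = P w x ⊗ sgU k w,
        forall PO' : {linear (R ⊗ semigroup_algebra k Omega)%type ->
                             (R ⊗ semigroup_algebra k Omega)%type},
          (forall (x : R) (w : Omega), PO' (x ⊗ sgU k w) = P w x ⊗ sgU k w) ->
          PO' =1 PO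
      & rota_baxter lambda PO].
Proof.
exists (family_op P); split; first exact: family_op_sgU.
  move=> PO' PO'E; apply: linear_sgU_eq => x w.
  by rewrite PO'E [RHS]family_op_sgU.
pose S t := exists x w, t = x ⊗ sgU k w :> (R ⊗ semigroup_algebra k Omega)%type.
apply: (@rota_baxter_span _ _ _ _ S)
  => [Q Q0 QS|_ _ [x [alpha ->]] [y [beta ->]]].
  by apply: tens_sgUW => // x w; apply: QS; exists x, w.
rewrite /rb_mul /= !family_op_sgU !amul_tpure !amul_sgU.
(* All three summands have right factor $\alpha\beta$, so they merge into one tensor, on which the
   operator acts by $P_{\alpha\beta}$. *)
by rewrite -tpureZl -!tpureDl family_op_sgU hP.
Qed.
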